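(* Let $(X,\xi)$ be a pointed coarse space. Then $[s]^{\sigma}_{X,\xi}=\mathcal{Q}_{S(X,\xi)}(s)$ for all $s\in S(X,\xi)$. Hence $\sigma(X,\xi)=\mathcal{Q}(S(X,\xi))$.
   Context: For binary relations $E,F\subseteq X\times X$: $E\circ F=\{(x,y) : (x,z)\in E \text{ and } (z,y)\in F \text{ for some } z\in X\}$, $E^{-1}=\{(y,x):(x,y)\in E\}$, $E^0=\Delta_X=\{(x,x):x\in X\}$, $E^{n+1}=E^n\circ E$. For maps $f,g\colon X\to Y$, $(f\times g)(E)=\{(f(x),g(y)):(x,y)\in E\}$. A coarse structure on a set $X$ is a family $\mathcal{C}_X$ of binary relations on $X$ such that $\Delta_X\in\mathcal{C}_X$; $E\subseteq F\in\mathcal{C}_X$ implies $E\in\mathcal{C}_X$; and $E,F\in\mathcal{C}_X$ implies $E\cup F, E\circ F, E^{-1}\in\mathcal{C}_X$. A set with a coarse structure is a coarse space; a pointed coarse space $(X,\xi)$ is a coarse space $X$ with a base point $\xi\in X$. A subset $A\subseteq X$ is bounded if $A\times A\in\mathcal{C}_X$; $\mathcal{B}_X$ is the family of bounded subsets. Metrics are allowed to take the value $\infty$. A metric space $(X,d)$ is endowed with the bounded coarse structure $\{E\subseteq X\times X : \sup d(E)<\infty\}\cup\{\varnothing\}$. $\mathbb{N}$ (containing $0$) carries its usual metric. A map $f\colon X\to Y$ between coarse spaces is proper if $f^{-1}(B)\in\mathcal{B}_X$ for all $B\in\mathcal{B}_Y$; bornologous if $(f\times f)(E)\in\mathcal{C}_Y$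 for all $E\in\mathcal{C}_X$; coarse if it is proper and bornologous. A coarse map $(X,\xi)\to(Y,\eta)$ of pointed coarse spaces is a coarse map $X\to Y$ sending $\xi$ to $\eta$. $S(X,\xi)$ is the set of all coarse maps $s\colon(\mathbb{N},0)\to(X,\xi)$ (coarse sequences). For $s,t\in S(X,\xi)$ write $s\sqsubseteq^{\sigma}_{X,\xi}t$ if $s$ is a subsequence of $t$, i.e. $s=t\circ\kappa$ for some strictly increasing $\kappa\colon\mathbb{N}\to\mathbb{N}$; $\sqsupseteq^{\sigma}_{X,\xi}$ is the inverse relation. Let $\equiv^{\sigma}_{X,\xi}$ be the smallest equivalence relation on $S(X,\xi)$ containing $\sqsubseteq^{\sigma}_{X,\xi}$, let $[s]^{\sigma}_{X,\xi}$ be the $\equiv^{\sigma}_{X,\xi}$-equivalence class of $s$, and let $\sigma(X,\xi)=S(X,\xi)/\equiv^{\sigma}_{X,\xi}$ be the set of these classes. $S(X,\xi)$ is equipped with the metric $d_{S(X,\xi)}(s,t)=\inf\{n\in\mathbb{N} : (s,t)\in(\sqsubseteq^{\sigma}_{X,\xi}\cup\sqsupseteq^{\sigma}_{X,\xi})^n\}\in\mathbb{N}\cup\{\infty\}$, with $\inf\varnothing=\infty$, and with the induced bounded coarse structure. For a coarse space $Z$ and $z\in Z$, the coarsely connected component of $Z$ containing $z$ is $\mathcal{Q}_Z(z)=\bigcup\{B : z\in B\in\mathcal{B}_Z\}$, and $\mathcal{Q}(Z)=\{\mathcal{Q}_Z(z): z\in Z\}$. *)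

(* Defs.v *)
From mathcomp Require Import all_boot all_order all_algebra.
From mathcomp Require Import all_classical all_reals all_analysis.
Import Order.TTheory GRing.Theory Num.Theory.

Set Implicit Arguments.
Unset Strict Implicit.
Unset Printing Implicit Defensive.

Local Open Scope classical_set_scope.
Local Open Scope ring_scope.

(* The library's [B \; A] composes in the opposite order: [relcomp E F] is
   [F \; E]. *)
Definition relcomp {X : Type} (E F : set (X * X)) : set (X * X) :=
  [set xy | exists2 z, E (xy.1, z) & F (z, xy.2)].

Fixpoint relpow {X : Type} (E : set (X * X)) (n : nat) : set (X * X) :=
  if n is m.+1 then relcomp (relpow E m) E else diagonal.

Definition prodmap {X Y : Type} (f g : X -> Y) (p : X * X) : Y * Y :=
  (f p.1, g p.2).

Definition is_equivalence {X : Type} (E : set (X * X)) : Prop :=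
  [/\ diagonal `<=` E, (E^-1)%relation `<=` E & relcomp E E `<=` E].

Lemma relpowD {X : Type} (E : set (X * X)) m n x y z :
  relpow E m (x, y) -> relpow E n (y, z) -> relpow E (m + n) (x, z).
Proof.
move=> xy; elim: n z => [|n IHn] z; first by rewrite addn0 => /diagonalP <-.
by rewrite addnS => -[w /= yw wz]; exists w => //=; exact: IHn.
Qed.

Lemma relpow_sym {X : Type} (E : set (X * X)) n x y :
  (E^-1)%relation `<=` E -> relpow E n (x, y) -> relpow E n (y, x).
Proof.
move=> Esym; elim: n y => [|n IHn] y; first by move=> /esym.
case=> z xz zy; rewrite -[n.+1]add1n; apply: (@relpowD _ _ 1 n _ z).
  by exists y => //; exact: Esym.
exact: IHn.
Qed.

Record coarseSpace := CoarseSpace {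
  carrier :> Type;
  controlled : set (set (carrier * carrier));
  controlled_diag : controlled diagonal;
  controlled_sub : forall E F, E `<=` F -> controlled F -> controlled E;
  controlledU : forall E F,
    controlled E -> controlled F -> controlled (E `|` F);
  controlled_comp : forall E F,
    controlled E -> controlled F -> controlled (relcomp E F);
  controlled_inv : forall E, controlled E -> controlled (E^-1)%relation }.

Definition bounded {X : coarseSpace} : set (set X) :=
  [set A | controlled (A `*` A)].

Definition proper {X Y : coarseSpace} (f : X -> Y) : Prop :=
  forall B, bounded B -> bounded (f @^-1` B).

Definition bornologous {X Y : coarseSpace} (f : X -> Y) : Prop :=
  forall E, controlled E -> controlled (prodmap f f @` E).

Definition coarse {X Y : coarseSpace} (f : X -> Y) : Prop :=
  proper f /\ bornologous f.

Definition pointed_coarse {X : coarseSpace} (xi : X) {Y : coarseSpace} (eta : Y)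
    (f : X -> Y) : Prop :=
  coarse f /\ f xi = eta.

Definition component {Z : coarseSpace} (z : Z) : set Z :=
  \bigcup_(B in [set B | B z /\ bounded B]) B.

Definition components (Z : coarseSpace) : set (set Z) :=
  [set component z | z in [set: Z]].

Record extMetricSpace (R : realType) := ExtMetricSpace {
  emcarrier :> Type;
  edist : emcarrier -> emcarrier -> \bar R;
  edist_ge0 : forall x y, (0 <= edist x y)%E;
  edist_eq0 : forall x y, edist x y = 0%E <-> x = y;
  edist_sym : forall x y, edist x y = edist y x;
  edist_triangle : forall x y z, (edist x z <= edist x y + edist y z)%E }.

Section BoundedCoarseStructure.
Context {R : realType} (X : extMetricSpace R).

(* The supremum of the empty set is [-oo] in [\bar R], so that [set0] already
   satisfies the first condition; listing it keeps the usual definition. *)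
Definition bounded_controlled : set (set (X * X)) :=
  [set E | (ereal_sup [set edist p.1 p.2 | p in E] < +oo)%E] `|` [set set0].

Lemma bounded_controlledP (E : set (X * X)) :
  bounded_controlled E <->
  exists M : R, forall x y, E (x, y) -> (edist x y <= M%:E)%E.
Proof.
split.
  case=> [/= Efin|->]; last by exists 0.
  have ub x y : E (x, y) ->
      (edist x y <= ereal_sup [set edist p.1 p.2 | p in E])%E.
    by move=> Exy; apply: ereal_sup_ubound; exists (x, y).
  move: Efin ub; case: (ereal_sup _) => [r||] Efin ub; [by exists r|by rewrite ltxx in Efin|].
  by exists 0 => x y /ub /le_trans; apply; exact: leNye.
case=> M EM; left; apply: (@le_lt_trans _ _ M%:E); last exact: ltry.
by apply: ge_ereal_sup => _ [[x y] Exy <-]; exact: EM.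
Qed.

Lemma bounded_controlled_diag : bounded_controlled diagonal.
Proof.
apply/bounded_controlledP; exists 0 => x y /diagonalP ->.
by rewrite (edist_eq0 y y).2.
Qed.

Lemma bounded_controlled_sub (E F : set (X * X)) :
  E `<=` F -> bounded_controlled F -> bounded_controlled E.
Proof.
move=> EF /bounded_controlledP[M FM]; apply/bounded_controlledP.
by exists M => x y /EF; exact: FM.
Qed.

Lemma bounded_controlledU (E F : set (X * X)) :
  bounded_controlled E -> bounded_controlled F ->
  bounded_controlled (E `|` F).
Proof.
move=> /bounded_controlledP[M EM] /bounded_controlledP[N FN].
apply/bounded_controlledP; exists (Num.max M N) => x y.
by case=> [/EM|/FN] /le_trans; apply; rewrite lee_fin le_max lexx ?orbT.
Qed.

Lemma bounded_controlled_comp (E F : set (X * X)) :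
  bounded_controlled E -> bounded_controlled F ->
  bounded_controlled (relcomp E F).
Proof.
move=> /bounded_controlledP[M EM] /bounded_controlledP[N FN].
apply/bounded_controlledP; exists (M + N) => x y [z /= /EM xz /FN zy].
by apply: (le_trans (edist_triangle x z y)); rewrite EFinD leeD.
Qed.

Lemma bounded_controlled_inv (E : set (X * X)) :
  bounded_controlled E -> bounded_controlled (E^-1)%relation.
Proof.
move=> /bounded_controlledP[M EM]; apply/bounded_controlledP.
by exists M => x y /= /EM; rewrite edist_sym.
Qed.

Definition coarse_of_metric : coarseSpace :=
  CoarseSpace bounded_controlled_diag bounded_controlled_sub
    bounded_controlledU bounded_controlled_comp bounded_controlled_inv.

End BoundedCoarseStructure.

Section NatMetric.
Context (R : realType).

Definition nat_dist (m n : nat) : \bar R := (`|m%:R - n%:R|%:E)%E.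

Lemma nat_dist_ge0 m n : (0 <= nat_dist m n)%E.
Proof. by rewrite lee_fin. Qed.

Lemma nat_dist_eq0 m n : nat_dist m n = 0%E <-> m = n.
Proof.
split=> [[]/eqP|->]; last by rewrite /nat_dist subrr normr0.
by rewrite normr_eq0 subr_eq0 eqr_nat => /eqP.
Qed.

Lemma nat_dist_sym m n : nat_dist m n = nat_dist n m.
Proof. by rewrite /nat_dist distrC. Qed.

Lemma nat_dist_triangle m n p :
  (nat_dist m p <= nat_dist m n + nat_dist n p)%E.
Proof. by rewrite -EFinD lee_fin ler_distD. Qed.

Definition nat_metric : extMetricSpace R :=
  ExtMetricSpace nat_dist_ge0 nat_dist_eq0 nat_dist_sym nat_dist_triangle.

Definition natCoarse : coarseSpace := coarse_of_metric nat_metric.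

End NatMetric.

Section PathDist.
Context (R : realType) {T : Type} (W : set (T * T)).

Definition path_dist (s t : T) : \bar R :=
  ereal_inf [set (n%:R%:E)%E | n in [set n : nat | relpow W n (s, t)]].

Lemma path_dist_le s t n : relpow W n (s, t) -> (path_dist s t <= n%:R%:E)%E.
Proof. by move=> st; apply: ereal_inf_lbound; exists n. Qed.

Lemma path_dist_attained s t :
  path_dist s t = +oo%E \/
  exists2 n, relpow W n (s, t) & path_dist s t = (n%:R%:E)%E.
Proof.
have [[n st]|nst] := pselect (exists n, relpow W n (s, t)); last first.
  left; rewrite /path_dist (_ : [set _ | _ in _] = set0) ?ereal_inf0 //.
  by rewrite -subset0 => ? [n st _]; apply: nst; exists n.
right.
have ex : exists n, `[< relpow W n (s, t) >]
  by exists n; apply/asboolP.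
case: (ex_minnP ex) => m /asboolP stm mmin; exists m => //.
apply/eqP; rewrite eq_le path_dist_le //=.
apply: le_ereal_inf_tmp => _ [k stk <-].
by rewrite lee_fin ler_nat; apply: mmin; apply/asboolP.
Qed.

Lemma path_dist_ge0 s t : (0 <= path_dist s t)%E.
Proof.
by case: (path_dist_attained s t) => [->|[n _ ->]]; rewrite ?leey ?lee_fin.
Qed.

Lemma path_dist_eq0 s t : path_dist s t = 0%E <-> s = t.
Proof.
split=> [|<-{t}]; last first.
  apply/eqP; rewrite eq_le path_dist_ge0 andbT.
  by have := @path_dist_le s s 0; rewrite mulr0n; apply.
case: (path_dist_attained s t) => [->//|[n st ->]] [] /eqP.
by rewrite pnatr_eq0 => /eqP n0; move: st; rewrite n0 => /diagonalP.
Qed.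

Lemma path_dist_sym : (W^-1)%relation `<=` W ->
  forall s t, path_dist s t = path_dist t s.
Proof.
move=> Wsym s t; rewrite /path_dist.
suff -> : [set n : nat | relpow W n (s, t)] = [set n | relpow W n (t, s)] by [].
by apply/seteqP; split=> n /=; exact: relpow_sym.
Qed.

Lemma path_dist_triangle s t u :
  (path_dist s u <= path_dist s t + path_dist t u)%E.
Proof.
case: (path_dist_attained s t) => [->|[m st ->]].
  by rewrite addye ?leey // gt_eqF // (lt_le_trans _ (path_dist_ge0 _ _)).
case: (path_dist_attained t u) => [->|[n tu ->]]; first by rewrite addey ?leey.
by rewrite -EFinD -natrD; apply: path_dist_le; exact: relpowD st tu.
Qed.

End PathDist.

Section CoarseSequences.
Context (R : realType) (X : coarseSpace) (xi : X).

Definition coarseSeq : Type :=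
  {s : natCoarse R -> X | pointed_coarse (0%N : natCoarse R) xi s}.

Definition seq_fun (s : coarseSeq) : nat -> X := sval s.

Definition subseqr : set (coarseSeq * coarseSeq) :=
  [set st | exists kappa : nat -> nat,
    {homo kappa : m n / (m < n)%N} /\ seq_fun st.1 = seq_fun st.2 \o kappa].

Definition seq_equiv : set (coarseSeq * coarseSeq) :=
  smallest is_equivalence subseqr.

Definition seq_class (s : coarseSeq) : set coarseSeq :=
  [set t | seq_equiv (s, t)].

Definition sigma : set (set coarseSeq) := [set seq_class s | s in setT].

Definition seq_dist : coarseSeq -> coarseSeq -> \bar R :=
  path_dist R (subseqr `|` (subseqr^-1)%relation).

Lemma seq_dist_sym s t : seq_dist s t = seq_dist t s.
Proof. by apply: path_dist_sym => -[? ?] /= [|]; [right|left]. Qed.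

Definition seq_metric : extMetricSpace R :=
  ExtMetricSpace (@path_dist_ge0 R _ _) (@path_dist_eq0 R _ _)
    seq_dist_sym (@path_dist_triangle R _ _).

Definition seqCoarse : coarseSpace := coarse_of_metric seq_metric.

End CoarseSequences.

Arguments subseqr R {X} xi.
Arguments seq_equiv R {X} xi.
Arguments sigma R {X} xi.
Arguments seqCoarse R {X} xi.
Arguments components Z : clear implicits.

(* Main.v *)
Require Import Defs.
From mathcomp Require Import all_boot all_order all_algebra.
From mathcomp Require Import all_classical all_reals all_analysis.

(** Two elements lie in the same class of the equivalence relation generated by
    [G] exactly when a finite zigzag of [G]-steps, taken forwards or backwards,
    joins them ([smallest_equivalenceE]).  The metric on coarse sequences is the
    length of the shortest such zigzag, so being equivalent means being at finite
    distance ([path_dist_ltyP]).  In the bounded coarse structure of a metric,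
    finite distance is also what defines coarsely connected components
    ([component_metricE]), since balls of finite radius are bounded. *)

Import Order.TTheory GRing.Theory Num.Theory.

Local Open Scope classical_set_scope.
Local Open Scope ring_scope.

Lemma relpow_sub_equivalence (T : Type) (W E : set (T * T)) (n : nat) :
  is_equivalence E -> W `<=` E -> relpow W n `<=` E.
Proof.
move=> [Erefl _ Etrans] WE; elim: n => [//|n IHn] [x y] [z /= xz zy].
by apply: Etrans; exists z; [exact: IHn|exact: WE].
Qed.

Lemma bigcup_relpow_equivalence (T : Type) (W : set (T * T)) :
  (W^-1)%relation `<=` W -> is_equivalence (\bigcup_n relpow W n).
Proof.
move=> Wsym; split; first by move=> p dp; exists 0%N.
- by move=> [x y] [n _ yx]; exists n => //; exact: relpow_sym.
- move=> [x y] [z [m _ xz] [n _ zy]].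
  by exists (m + n)%N => //; exact: relpowD xz zy.
Qed.

(** Zigzags compose and can be reversed, so they form an equivalence relation
    containing [G]; any other such relation absorbs a zigzag step by step. *)
Lemma smallest_equivalenceE (T : Type) (G : set (T * T)) :
  smallest is_equivalence G = \bigcup_n relpow (G `|` (G^-1)%relation) n.
Proof.
apply/seteqP; split.
  apply: smallest_sub => [|[x y] Gxy].
    by apply: bigcup_relpow_equivalence => -[x y] /= [|]; [right|left].
  by exists 1%N => //; exists x => //; left.
move=> p [n _ np] E [Eeq GE]; apply: relpow_sub_equivalence np => //.
by case: Eeq => _ Esym _ [x y] [|yx]; [exact: GE|apply: Esym; exact: GE].
Qed.

Lemma path_dist_ltyP (R : realType) (T : Type) (W : set (T * T)) (s t : T) :
  (path_dist R W s t < +oo)%E <-> exists n, relpow W n (s, t).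
Proof.
split=> [|[n st]]; last exact: le_lt_trans (path_dist_le R st) (ltry _).
by case: (path_dist_attained R W s t) => [->|[n st _] _]; [rewrite ltxx|exists n].
Qed.

(** Balls of finite radius are bounded by the triangle inequality, so every
    point at finite distance from [z] shares a bounded set with [z]. *)
Lemma component_metricE (R : realType) (M : extMetricSpace R) (z : M) :
  component (z : coarse_of_metric M) = [set t | (Defs.edist z t < +oo)%E].
Proof.
apply/seteqP; split=> t /=.
  move=> [B [Bz /bounded_controlledP[r Br]] Bt].
  by apply: le_lt_trans (ltry r); exact: Br.
move=> zt; have zt_fin : Defs.edist z t \is a fin_num.
  by rewrite ge0_fin_numE ?Defs.edist_ge0.
exists [set u | (Defs.edist z u <= Defs.edist z t)%E] => //=; split.
  by rewrite /= (Defs.edist_eq0 z z).2 ?Defs.edist_ge0.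
apply/bounded_controlledP; exists (fine (Defs.edist z t) + fine (Defs.edist z t)).
move=> x y [/= zx zy]; rewrite EFinD fineK //.
apply: (le_trans (Defs.edist_triangle x z y)).
by rewrite Defs.edist_sym leeD.
Qed.

Theorem theorem4p1 (R : realType) (X : coarseSpace) (xi : X) :
  (forall s : coarseSeq R xi, seq_class s = component (s : seqCoarse R xi)) /\
  sigma R xi = components (seqCoarse R xi).
Proof.
have classE (s : coarseSeq R xi) :
    seq_class s = component (s : seqCoarse R xi).
  rewrite component_metricE /seq_class /seq_equiv smallest_equivalenceE.
  apply/seteqP; split=> t /=.
    by move=> [n _ st]; apply/path_dist_ltyP; exists n.
  by move=> /path_dist_ltyP[n st]; exists n.
split=> //; rewrite /sigma /components.
by apply/seteqP; split=> _ [s _ <-]; exists s => //; rewrite classE.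
Qed.
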